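(* Let $A$ be an affine semigroup and $p>0$ a prime integer. If $k$ is a field of characteristic $p$, then ${}^{*}k[A]=k[{}^{*p}A]$, i.e. the weak normalization of the affine semigroup ring $k[A]$ is the affine semigroup ring of the $p$-weak normalization of $A$.
   Context: $\mathbb{N}$ contains $0$. An affine semigroup is a finitely generated submonoid $A$ of $\mathbb{N}^n$. $G(A)\subset\mathbb{Z}^n$ is the subgroup generated by $A$, $C(A)$ is the cone of non-negative real combinations of elements of $A$, and $\overline{A}=G(A)\cap C(A)$. For a prime $p$, the $p$-weak normalization of $A$ is ${}^{*p}A=\{\mathbf{v}\in\overline{A}\mid p^e\mathbf{v}\in A\text{ for some }e\in\mathbb{N}\}$, which is again an affine semigroup. For an affine semigroup $B\subset\mathbb{N}^n$, $k[B]$ is the $k$-subalgebra of $k[x_1,\dots,x_n]$ spanned by the monomials $\mathbf{x}^{\mathbf{b}}$, $\mathbf{b}\in B$. For a reduced Noetherian ring $R$ of characteristic $p$ with total ring of quotients $Q$, the weak normalization of $R$ is ${}^{*}R=\{r\in Q\mid r^{p^e}\in R\text{ for some }e\in\mathbb{N}\}$, the largest purely inseparable extension of $R$ inside $Q$. The equality is as subrings of the fraction field of $k[A]$ (which contains $k[\overline{A}]\supset k[{}^{*p}A]$). *)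

(* Defs.v *)
From HB Require Import structures.
From mathcomp Require Import all_boot all_order all_algebra.
From mathcomp Require Import reals.
From mathcomp Require Import mpoly.

Set Implicit Arguments.
Unset Strict Implicit.
Unset Printing Implicit Defensive.

Import Order.TTheory GRing.Theory Num.Theory.
Local Open Scope ring_scope.

(* N^n is the type 'X_{1..n} of exponent vectors, so that v : 'X_{1..n} is
   also the exponent of the monomial 'X_[v]. Subsets are Prop-valued
   predicates. *)

Inductive subgroup_generated (V : zmodType) (S : V -> Prop) : V -> Prop :=
| subgroup_gen v : S v -> subgroup_generated S v
| subgroup_0 : subgroup_generated S 0
| subgroup_B u v : subgroup_generated S u -> subgroup_generated S v ->
    subgroup_generated S (u - v).

Section AffineSemigroup.
Variable n : nat.
Implicit Types (A : 'X_{1..n} -> Prop) (u v : 'X_{1..n}) (z : 'rV[int]_n).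

Inductive submonoid_generated (S : 'X_{1..n} -> Prop) : 'X_{1..n} -> Prop :=
| submonoid_gen v : S v -> submonoid_generated S v
| submonoid_0 : submonoid_generated S 0%MM
| submonoid_D u v : submonoid_generated S u -> submonoid_generated S v ->
    submonoid_generated S (u + v)%MM.

Definition affine_semigroup A : Prop :=
  exists gens : seq 'X_{1..n},
    forall v, A v <-> submonoid_generated (fun g => g \in gens) v.

Definition mnm_int v : 'rV[int]_n := \row_i (v i)%:Z.

Definition int_real (R : realType) z : 'rV[R]_n := map_mx (fun a => a%:~R) z.

Definition semigroup_group A : 'rV[int]_n -> Prop :=
  subgroup_generated (fun z => exists2 a, A a & z = mnm_int a).

Definition semigroup_cone (R : realType) A (x : 'rV[R]_n) : Prop :=
  exists (r : nat) (c : 'I_r -> R) (a : 'I_r -> 'X_{1..n}),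
    (forall i, 0 <= c i /\ A (a i)) /\
    x = \sum_(i < r) c i *: int_real R (mnm_int (a i)).

Definition normalization (R : realType) A z : Prop :=
  semigroup_group A z /\ semigroup_cone A (int_real R z).

(* Only v in N^n are considered; nothing is lost, by normalization_nat. *)
Definition p_weak_normalization (R : realType) (p : nat) A v : Prop :=
  normalization R A (mnm_int v) /\ exists e : nat, A (v *+ (p ^ e))%MM.

Lemma normalization_nat (R : realType) A z :
  normalization R A z -> exists v, z = mnm_int v.
Proof.
case=> _ [r [c [a [cA zE]]]].
have z_ge0 i : 0 <= z 0 i.
  have : 0 <= int_real R z 0 i.
    rewrite zE summxE; apply: sumr_ge0 => j _.
    by rewrite !mxE mulr_ge0 ?ler0z //; case: (cA j).
  by rewrite mxE ler0z.
exists [multinom `|z 0%R i|%N | i < n]; apply/rowP => i.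
by rewrite mxE mnmE gez0_abs.
Qed.

(* The k-linear span of the monomials with exponent in B. *)
Definition semigroup_ring (k : fieldType) (B : 'X_{1..n} -> Prop)
    (f : {mpoly k[n]}) : Prop :=
  exists (r : nat) (c : 'I_r -> k) (b : 'I_r -> 'X_{1..n}),
    (forall i, B (b i)) /\ f = \sum_(i < r) c i *: 'X_[b i].

(* k[B] inside the field of fractions of k[x_1, ..., x_n]. *)
Definition semigroup_ring_frac (k : fieldType) (B : 'X_{1..n} -> Prop)
    (x : {fraction {mpoly k[n]}}) : Prop :=
  exists2 f, semigroup_ring B f & x = tofrac f.

End AffineSemigroup.

(* A subring S of a field K is a domain, so its total ring of quotients is the
   field of fractions a / b inside K, with a, b in S and b != 0. *)
Definition quotient_ring (K : fieldType) (S : K -> Prop) (x : K) : Prop :=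
  exists a b : K, [/\ S a, S b, b != 0 & x = a / b].

Definition weak_normalization (K : fieldType) (p : nat) (S : K -> Prop)
    (x : K) : Prop :=
  quotient_ring S x /\ exists e : nat, S (x ^+ (p ^ e)).

(* Main.v *)
(* If x = f / g with f, g in k[A] and x ^ q = h in k[A], where q = p ^ e, then
   h is the quotient of f ^ q by g ^ q; long division shows that it is the q-th
   power of a polynomial u, so x = u. The support of u ^ q is q times that of u,
   so q m lies in A for each exponent m of u, whence m lies in the cone; and m
   lies in G(A) because u g = f. Conversely, the exponents of a polynomial over
   the p-weak normalization have a common denominator in A and a common power of
   p multiplying them into A. *)

Require Import Defs.
From HB Require Import structures.
From mathcomp Require Import all_boot all_order all_algebra.
From mathcomp Require Import boolp reals.
From mathcomp Require Import mpoly.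

Set Implicit Arguments.
Unset Strict Implicit.
Unset Printing Implicit Defensive.

Import Order.TTheory GRing.Theory Num.Theory.
Local Open Scope ring_scope.

(** * Closure properties of an affine semigroup *)

Section Affine.
Context {n : nat} {A : 'X_{1..n} -> Prop}.
Hypothesis affA : affine_semigroup A.

Lemma affine_semigroup0 : A 0%MM.
Proof. by case: affA => gens ->; exact: submonoid_0. Qed.

Lemma affine_semigroupD u v : A u -> A v -> A (u + v)%MM.
Proof. by case: affA => gens AE; rewrite !AE; exact: submonoid_D. Qed.

Lemma affine_semigroupMn u r : A u -> A (u *+ r)%MM.
Proof.
move=> Au; elim: r => [|r IHr]; first by rewrite mulm0n; exact: affine_semigroup0.
by rewrite mulmS; exact: affine_semigroupD.
Qed.

Lemma affine_semigroup_sum (I : Type) (s : seq I) (P : pred I)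
    (F : I -> 'X_{1..n}) :
  (forall i, P i -> A (F i)) -> A (\big[mnm_add/0%MM]_(i <- s | P i) F i).
Proof.
move=> AF; apply: (big_ind A) => //; first exact: affine_semigroup0.
exact: affine_semigroupD.
Qed.

End Affine.

(** * The group [G(A)] inside [Z^n] *)

Section Group.
Context {n : nat} {A : 'X_{1..n} -> Prop}.
Implicit Types u v : 'X_{1..n}.

Lemma mnm_intD u v : mnm_int (u + v)%MM = mnm_int u + mnm_int v.
Proof. by apply/rowP => i; rewrite !mxE mnmDE PoszD. Qed.

Lemma mnm_int_inj : injective (@mnm_int n).
Proof. by move=> u v /rowP uv; apply/mnmP => i; have := uv i; rewrite !mxE => -[]. Qed.

(** The differences of elements of [A] already form a subgroup, since
    [(a - b) - (c - d) = (a + d) - (b + c)]. *)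
Lemma semigroup_group_diff z : affine_semigroup A -> semigroup_group A z ->
  exists a b, [/\ A a, A b & z = mnm_int a - mnm_int b].
Proof.
move=> affA; elim=> [_ [a Aa ->]||x y _ [a [b [Aa Ab ->]]] _ [c [d [Ac Ad ->]]]].
- exists a, 0%MM; split=> //; first exact: affine_semigroup0.
  by apply/rowP => i; rewrite !mxE mnmE subr0.
- by exists 0%MM, 0%MM; rewrite subrr; split=> //; exact: affine_semigroup0.
- exists (a + d)%MM, (b + c)%MM; split; [exact: affine_semigroupD..|].
  by rewrite !mnm_intD opprB opprD addrACA.
Qed.

Lemma semigroup_groupD x y :
  semigroup_group A x -> semigroup_group A y -> semigroup_group A (x + y).
Proof.
move=> Gx Gy; rewrite -[y]opprK; apply: subgroup_B => //.
by rewrite -sub0r; apply: subgroup_B => //; exact: subgroup_0.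
Qed.

Lemma semigroup_group_mnmDr u a : A a ->
  semigroup_group A (mnm_int (u + a)%MM) -> semigroup_group A (mnm_int u).
Proof.
move=> Aa Gua; rewrite -[mnm_int u](addrK (mnm_int a)) -mnm_intD.
by apply: subgroup_B => //; apply: subgroup_gen; exists a.
Qed.

End Group.

(** * Supports of polynomials in [k[A]] *)

Section SemigroupRing.
Context {n : nat} {k : fieldType}.
Implicit Types (B : 'X_{1..n} -> Prop) (f g : {mpoly k[n]}).

Lemma semigroup_ringP B f :
  semigroup_ring B f <-> (forall m, m \in msupp f -> B m).
Proof.
split=> [[r [c [b [Bb ->]]]] m /msupp_sum_le/flatten_mapP[i _]|Bf].
  by move=> /msuppZ_le; rewrite msuppX inE => /eqP->.
exists (size (msupp f)), (fun i => f@_(tnth (in_tuple (msupp f)) i)).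
exists (tnth (in_tuple (msupp f))); split=> [i|].
  exact/Bf/mem_tnth.
by rewrite {1}[f]mpolyE -(big_tnth _ _ _ xpredT (fun m => f@_m *: 'X_[m])).
Qed.

Lemma semigroup_ring_mulX B f a :
  (forall m, m \in msupp f -> B (m + a)%MM) -> semigroup_ring B (f * 'X_[a]).
Proof.
move=> Bfa; apply/semigroup_ringP => m /msuppM_le/allpairsP[[u v] /= [uf]].
by rewrite msuppX inE => /eqP-> ->; exact: Bfa.
Qed.

(* The ring is graded by Z^n / G(A); multiplying by [g], which has degree 0,
   keeps apart the parts of [f] inside and outside degree 0. *)
Lemma msupp_group_factor A f g : g != 0 -> affine_semigroup A ->
    semigroup_ring A g -> semigroup_ring A (f * g) ->
  forall m, m \in msupp f -> semigroup_group A (mnm_int m).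
Proof.
move=> g0 affA /semigroup_ringP Ag /semigroup_ringP Afg.
pose inG m := `[< semigroup_group A (mnm_int m) >].
pose part (P : pred 'X_{1..n}) := \sum_(m <- msupp f | P m) f@_m *: 'X_[m].
have partE P m : m \in msupp (part P) -> P m.
  move=> /msupp_sum_le/flatten_mapP[i]; rewrite mem_filter => /andP[Pi _].
  by move=> /msuppZ_le; rewrite msuppX inE => /eqP->.
have fE : f = part inG + part (predC inG).
  by rewrite {1}[f]mpolyE (bigID inG).
have AG a : A a -> semigroup_group A (mnm_int a).
  by move=> Aa; apply: subgroup_gen; exists a.
have [out0|out0] := eqVneq (part (predC inG)) 0.
  by move=> m; rewrite fE out0 addr0 => /partE/asboolP.
have: part (predC inG) * g != 0 by rewrite mulf_neq0.
(* Any exponent of this product serves; take the leading one, [l = u + a] with [u] outside [G(A)]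
   and [a] in [A]. The product is also [f * g - part inG * g], and both of these terms have all
   exponents in [G(A)]. So [l], and with it [u], would lie in [G(A)]. *)
move=> /mlead_supp; set l := mlead _ => lout.
have /allpairsP[[u a] /= [/partE/asboolPn Gu /Ag Aa lE]] := msuppM_le lout.
case: Gu; apply: (semigroup_group_mnmDr Aa); rewrite -lE.
have outE : part (predC inG) * g = f * g - part inG * g.
  by apply/eqP; rewrite eq_sym subr_eq addrC -mulrDl -fE.
move: lout; rewrite outE => /msuppB_le; rewrite mem_cat => /orP[/Afg/AG//|].
move=> /msuppM_le/allpairsP[[v b] /= [/partE/asboolP Gv /Ag/AG Gb ->]].
by rewrite mnm_intD; exact: semigroup_groupD.
Qed.

End SemigroupRing.

Lemma mulmn_inj {n : nat} q : (0 < q)%N ->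
  injective (fun m : 'X_{1..n} => m *+ q)%MM.
Proof.
move=> q0 u v /mnmP uv; apply/mnmP => i; have := uv i.
by rewrite !mulmnE => /eqP; rewrite eqn_pmul2r // => /eqP.
Qed.

Lemma pnat_pchar_pexp {k : fieldType} {p : nat} e :
  p \in [pchar k] -> [pchar k].-nat (p ^ e)%N.
Proof.
move=> pk; rewrite pnatX (eq_pnat _ (pcharf_eq pk)) pnat_id //.
exact: pcharf_prime pk.
Qed.

(** * Powers of polynomials by powers of the characteristic *)

Section Frobenius.
Context {n : nat} {k : fieldType} {q : nat}.
Hypothesis qP : [pchar k].-nat q.
Implicit Types f g h : {mpoly k[n]}.

Let q_gt0 : (0 < q)%N. Proof. by case/andP: qP. Qed.

Lemma mpoly_pcharD f g : (f + g) ^+ q = f ^+ q + g ^+ q.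
Proof. by rewrite exprDn_pchar // (eq_pnat _ (pchar_lalg _)). Qed.

Lemma mpoly_pcharB f g : (f - g) ^+ q = f ^+ q - g ^+ q.
Proof. by rewrite -[f in RHS](subrK g) (mpoly_pcharD _ g) addrK. Qed.

Lemma mpoly_pchar_inj : injective (fun f => f ^+ q).
Proof.
move=> f g /= /eqP; rewrite -subr_eq0 -mpoly_pcharB expf_eq0 => /andP[_].
by rewrite subr_eq0 => /eqP.
Qed.

Lemma mpoly_pchar_sum (I : Type) (s : seq I) (F : I -> {mpoly k[n]}) :
  (\sum_(i <- s) F i) ^+ q = \sum_(i <- s) F i ^+ q.
Proof.
apply: (big_morph _ mpoly_pcharD).
by rewrite expr0n gtn_eqF.
Qed.

Lemma mpoly_pcharE f : f ^+ q = \sum_(m <- msupp f) f@_m ^+ q *: 'X_[m *+ q].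
Proof.
rewrite {1}[f]mpolyE mpoly_pchar_sum; apply: eq_bigr => m _.
by rewrite exprZn mpolyXn.
Qed.

(** Multiplying exponents by [q] is injective, so the terms of [f ^+ q] do not collide, and the
    support of [f] can be read off from that of [f ^+ q]. *)
Lemma mcoeff_pchar f m : (f ^+ q)@_(m *+ q) = f@_m ^+ q.
Proof.
rewrite mpoly_pcharE raddf_sum /= [f in RHS]mpolyE raddf_sum /=.
rewrite (big_morph (fun x : k => x ^+ q) (id1 := 0) (op1 := +%R)).
- apply: eq_bigr => i _; rewrite !mcoeffZ !mcoeffX (inj_eq (mulmn_inj q_gt0)).
  by rewrite exprMn; case: eqP; rewrite ?expr1n ?expr0n ?gtn_eqF.
- by move=> x y; rewrite exprDn_pchar.
- by rewrite expr0n gtn_eqF.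
Qed.

(* Long division of [f ^+ q] by [g ^+ q]: each leading term of the quotient is
   the [q]-th power of the corresponding term in the division of [f] by [g]. *)
Lemma quotient_of_powers f g h : g != 0 -> f ^+ q = h * g ^+ q ->
  exists u, h = u ^+ q.
Proof.
(* Induction on the leading monomial of [h], for all [f] at once: a division step replaces [f] by
   [f - t * g] and [h] by [h - t ^+ q]. *)
move=> g0; elim/mleadrect: h f => h IHh f fE.
have [->|h0] := eqVneq h 0; first by exists 0; rewrite expr0n gtn_eqF.
have f0 : f != 0.
  by apply/eqP => f0; move/eqP: fE; rewrite f0 expr0n gtn_eqF // eq_sym
     mulf_eq0 (negPf h0) expf_eq0 (negPf g0) andbF.
have leadE : (mlead f *+ q = mlead h + mlead g *+ q)%MM.
  by rewrite -!mleadX // fE mleadM // expf_neq0.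
have lecE : mleadc f ^+ q = mleadc h * mleadc g ^+ q.
  by rewrite -!mleadcX leadE fE -[(mlead g *+ q)%MM]mleadX // mleadcM.
(* By [leadE], [q] times [mlead f] dominates [q] times [mlead g] in each coordinate; cancel [q]. *)
have gf : (mlead g <= mlead f)%MM.
  apply/mnm_lepP => i; rewrite -(leq_pmul2r q_gt0) -!mulmnE leadE mnmDE.
  exact: leq_addl.
pose m := (mlead f - mlead g)%MM.
have mE : (m *+ q)%MM = mlead h.
  apply: (@addIm _ (mlead g *+ q)%MM); rewrite -leadE; apply/mnmP => i.
  by rewrite mnmDE !mulmnE -mulnDl -mnmDE submK.
pose c := mleadc f / mleadc g.
have cE : c ^+ q = mleadc h.
  by rewrite exprMn exprVn lecE mulfK // expf_neq0 // mleadc_eq0.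
pose t : {mpoly k[n]} := c *: 'X_[m].
have tE : t ^+ q = mleadc h *: 'X_[mlead h] by rewrite exprZn mpolyXn mE cE.
(* A zero remainder is treated apart: [mlead 0] is the zero exponent, so for constant [h] the
   leading monomial would not drop. *)
have [h'0|h'0] := eqVneq (h - t ^+ q) 0.
  by exists t; apply/eqP; rewrite -subr_eq0 h'0.
have [||u uE] := IHh (h - t ^+ q) _ (f - t * g).
- rewrite lt_neqAle; apply/andP; split.
    (* The terms at [mlead h] cancel, so an unchanged leading monomial would have coefficient 0. *)
    apply/eqP => E; move: h'0; rewrite -mleadc_eq0 E tE.
    by rewrite mcoeffB mcoeffZ mcoeffX eqxx mulr1 subrr eqxx.
  apply: le_trans (mleadB_le _ _) _; rewrite leUx lexx /= tE.
  by apply: le_trans (mleadZ_le _ _) _; rewrite mleadXm.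
- by rewrite mpoly_pcharB exprMn fE mulrBl.
- by exists (u + t); rewrite mpoly_pcharD -uE subrK.
Qed.

(** From [h = u ^+ q] one gets [f ^+ q = (u * g) ^+ q], and taking [q]-th powers is injective. *)
Lemma division_of_powers f g h : g != 0 -> f ^+ q = h * g ^+ q ->
  exists2 u, h = u ^+ q & f = u * g.
Proof.
move=> g0 fE; have [u uE] := @quotient_of_powers f g h g0 fE.
by exists u => //; apply: mpoly_pchar_inj; rewrite /= fE uE exprMn.
Qed.

End Frobenius.

(** * Cone membership, common denominators and common powers of [p] *)

Lemma semigroup_cone_Mn (R : realType) {n : nat} (A : 'X_{1..n} -> Prop) m q :
  (0 < q)%N -> A (m *+ q)%MM -> semigroup_cone A (int_real R (mnm_int m)).
Proof.
move=> q0 Amq; exists 1%N, (fun=> q%:R^-1), (fun=> (m *+ q)%MM); split=> [_|].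
  by rewrite invr_ge0 ler0n.
apply/rowP => i; rewrite big_ord1 !mxE mulmnE PoszM intrM mulrC -pmulrn mulfK //.
by rewrite pnatr_eq0 -lt0n.
Qed.

(** Each exponent of [f] is a difference of elements of [A]. The sum [d] of all the subtracted
    elements is a common denominator: ['X_[d]] and [f * 'X_[d]] both lie in [k[A]]. *)
Lemma semigroup_ring_quotient {n : nat} {k : fieldType} {A : 'X_{1..n} -> Prop}
    (f : {mpoly k[n]}) : affine_semigroup A ->
    (forall m, m \in msupp f -> semigroup_group A (mnm_int m)) ->
  quotient_ring (semigroup_ring_frac (k := k) A) (tofrac f).
Proof.
move=> affA Gf.
have /choice[a aP] : forall m, exists a,
    m \in msupp f -> A a /\ A (m + a)%MM.
  move=> m.
  have [mf|] := boolP (m \in msupp f); last by exists 0%MM.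
  have [b [d [Ab Ad E]]] := semigroup_group_diff affA (Gf m mf).
  exists d => _; split=> //; suff -> : (m + d)%MM = b by [].
  by apply: mnm_int_inj; rewrite mnm_intD E subrK.
pose d := (\big[mnm_add/0%MM]_(m <- msupp f) a m)%MM.
have Ad : A d.
  rewrite /d big_seq; apply: (affine_semigroup_sum affA) => m mf.
  by case: (aP m mf).
(* Split the summand [a m] off [d]: [m + a m] is in [A] by the choice of [a], and so is the rest of
   the sum. *)
have Amd m : m \in msupp f -> A (m + d)%MM.
  move=> mf; rewrite /d (bigD1_seq m) //= ?msupp_uniq // addmA.
  apply: (affine_semigroupD affA); first by case: (aP m mf).
  rewrite big_seq_cond; apply: (affine_semigroup_sum affA) => i /andP[fi _].
  by case: (aP i fi).
have X0 : tofrac ('X_[d] : {mpoly k[n]}) != 0.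
  by rewrite tofrac_eq0 -mleadc_eq0 mleadXm mcoeffX eqxx oner_neq0.
exists (tofrac (f * 'X_[d])), (tofrac 'X_[d]); split=> //.
- by exists (f * 'X_[d]) => //; exact: semigroup_ring_mulX.
- exists 'X_[d] => //; apply/semigroup_ringP => m.
  by rewrite msuppX inE => /eqP->.
- by rewrite tofracM mulfK.
Qed.

(** The support is finite, so the largest of the individual exponents [e m] works for all [m]:
    multiplying by further powers of [p] stays in [A]. *)
Lemma semigroup_ring_pchar_power {n : nat} {k : fieldType} {p : nat}
    {A : 'X_{1..n} -> Prop} (f : {mpoly k[n]}) :
    p \in [pchar k] -> affine_semigroup A ->
    (forall m, m \in msupp f -> exists e, A (m *+ p ^ e)%MM) ->
  exists e, semigroup_ring A (f ^+ (p ^ e)).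
Proof.
move=> pk affA ef.
have /choice[e eP] : forall m, exists e, m \in msupp f -> A (m *+ p ^ e)%MM.
  move=> m.
  have [mf|] := boolP (m \in msupp f); last by exists 0%N.
  by have [d dP] := ef m mf; exists d.
pose E := (\max_(m <- msupp f) e m)%N; exists E.
apply/semigroup_ringP => v; rewrite (mpoly_pcharE (pnat_pchar_pexp E pk)).
move=> /msupp_sum_le/flatten_mapP[m]; rewrite filter_predT => mf.
move=> /msuppZ_le; rewrite msuppX inE => /eqP->.
have /subnKC <- : (e m <= E)%N by exact: leq_bigmax_seq.
have -> : (m *+ p ^ (e m + (E - e m)) = m *+ p ^ e m *+ p ^ (E - e m))%MM.
  by apply/mnmP => i; rewrite !mulmnE expnD mulnA.
exact/(affine_semigroupMn affA)/eP.
Qed.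

Theorem proposition3p5 (R : realType) (n : nat) (A : 'X_{1..n} -> Prop)
    (p : nat) (k : fieldType) :
  affine_semigroup A -> prime p -> p \in [pchar k] ->
  forall x : {fraction {mpoly k[n]}},
    weak_normalization p (semigroup_ring_frac (k := k) A) x <->
    semigroup_ring_frac (k := k) (p_weak_normalization R p A) x.
Proof.
move=> affA p_pr pk x; split.
  case=> -[_ [_ [[f Af ->] [g Ag ->]]]]; rewrite tofrac_eq0 => g0 ->.
  case=> e [h Ah hE]; set q := (p ^ e)%N in hE *.
  have qP : [pchar k].-nat q := pnat_pchar_pexp e pk.
  (* Clear denominators in [(f / g) ^+ q = h], then return to polynomials by injectivity of
     [tofrac]. *)
  have fE : f ^+ q = h * g ^+ q.
    apply/eqP; rewrite -tofrac_eq tofracM -hE !tofracXn exprMn exprVn divfK //.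
    by rewrite expf_neq0 ?tofrac_eq0.
  have [u uE fu] := division_of_powers qP g0 fE.
  exists u; last by rewrite fu tofracM mulfK // tofrac_eq0.
  apply/semigroup_ringP => m mu.
  have Amq : A (m *+ q)%MM.
    move/semigroup_ringP: Ah; apply.
    by rewrite mcoeff_msupp uE (mcoeff_pchar qP) expf_neq0 // -mcoeff_msupp.
  split; last by exists e.
  split; first by apply: (msupp_group_factor g0 affA Ag _ mu); rewrite -fu.
  by apply: (@semigroup_cone_Mn _ _ _ _ q); rewrite // expn_gt0 prime_gt0.
case=> f /semigroup_ringP Bf ->; split.
  by apply: semigroup_ring_quotient => // m /Bf[[]].
have [|e Ae] := semigroup_ring_pchar_power pk affA (f := f).
  by move=> m /Bf[].
by exists e; exists (f ^+ (p ^ e)) => //; rewrite tofracXn.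
Qed.
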